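(* Let $A$ be a ring and $S=A[\underline{t};\sigma,\underline{\delta}]$ a multivariate Ore extension in $n$ variables. For every $f(\underline{t})\in S$ and every $\underline{a}\in A^n$ we have $$f(\underline{a})=f(T_{\underline{a}})(1).$$
   Context: All rings are associative with identity, and ring homomorphisms preserve the identity. Let $A$ be a ring, $n\ge 1$, $\sigma:A\to M_n(A)$ a ring homomorphism, and write $\sigma_{ij}(a)$ for the $(i,j)$ entry of $\sigma(a)$. Let $\underline{\delta}=(\delta_1,\dots,\delta_n)^t$ be a column of additive maps $A\to A$ forming a $\sigma$-derivation: $\delta_i(ab)=\sum_{j=1}^n\sigma_{ij}(a)\delta_j(b)+\delta_i(a)b$ for all $a,b\in A$, $1\le i\le n$. The multivariate Ore extension $S=A[\underline{t};\sigma,\underline{\delta}]$ is the ring of (finite) sums $\sum_{m\in M}\alpha_m m$, $\alpha_m\in A$, where $M$ is the free monoid on the variables $t_1,\dots,t_n$ (so $S$ is a free left $A$-module with basis $M$), with multiplication determined by concatenation in $M$ and the rules $t_ia=\sum_{j=1}^n\sigma_{ij}(a)t_j+\delta_i(a)$ for $a\in A$, $1\le i\le n$. Evaluation: for $\underline{a}=(a_1,\dots,a_n)^t\in A^n$ let $I=S(t_1-a_1)+\cdots+S(t_n-a_n)$, a left ideal of $S$. Every class in $S/I$ is represented by a unique element of $A$; the evaluation $f(\underline{a})$ is the element of $A$ representing $f(\underline{t})+I$. The map $T_{\underline{a}}$: $T_{\underline{a}}=(T_{a_1},\dots,T_{a_n})^t$, where $T_{a_i}:A\to A$ is the additive map $T_{a_i}(b)=\sum_{j=1}^n\sigma_{ij}(b)a_j+\delta_i(b)$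 (so $T_{a_i}$ depends on the whole of $\underline{a}$). For $f=\sum_m\alpha_m m\in S$, $f(T_{\underline{a}})\in \mathrm{End}(A,+)$ is obtained by replacing each $t_i$ by $T_{a_i}$ (words become compositions) and each coefficient $\alpha$ by left multiplication by $\alpha$ on $A$. *)

(* Defs.v *)
From HB Require Import structures.
From mathcomp Require Import all_boot all_order all_algebra.
From mathcomp Require Import finmap.
From mathcomp.multinomials Require Import monalg.
From Stdlib Require Import ClassicalEpsilon.

Set Implicit Arguments.
Unset Strict Implicit.
Unset Printing Implicit Defensive.

Import GRing.Theory.
Local Open Scope ring_scope.

(* Additive maps delta_1, ..., delta_n; pzRingType allows the zero ring. *)
Record sigma_derivation (A : pzRingType) (n : nat)
    (sigma : {rmorphism A -> 'M[A]_n}) := SigmaDerivation {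
  sder : 'I_n -> {additive A -> A};
  sderM : forall (i : 'I_n) (a b : A),
    sder i (a * b) = \sum_(j < n) sigma a i j * sder j b + sder i a * b
}.

(* The word i_1 ... i_k acts as the composition T i_1 \o ... \o T i_k. *)
Definition word_act (n : nat) (V : Type) (T : 'I_n -> V -> V)
  (m : {fmonom 'I_n}) (v : V) : V := foldr T v m.

Section WordAct.
Context (n : nat).
Implicit Types (i : 'I_n) (m : {fmonom 'I_n}).

Lemma fmonom_ind (P : {fmonom 'I_n} -> Prop) :
  P mone -> (forall i m, P m -> P (mmul (fmu i) m)) -> forall m, P m.
Proof.
move=> P1 PM [s]; elim: s => [|i s IHs].
  by rewrite (_ : FMonom [::] = mone) //; apply: val_inj; rewrite /= fm1.
rewrite (_ : FMonom (i :: s) = mmul (fmu i) (FMonom s)); first exact: PM.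
by apply: val_inj; rewrite /= fmM fmU.
Qed.

Context (V : Type) (T : 'I_n -> V -> V).

Lemma word_act1 v : word_act T mone v = v.
Proof. by rewrite /word_act fm1. Qed.

Lemma word_actX i v : word_act T (fmu i) v = T i v.
Proof. by rewrite /word_act fmU. Qed.

Lemma word_actM m m' v : word_act T (mmul m m') v = word_act T m (word_act T m' v).
Proof. by rewrite /word_act fmM foldr_cat. Qed.

End WordAct.

(* S is the free left A-module on the free monoid {fmonom 'I_n}; delta occurs
   in the type only so that the multiplication can depend on it. *)
Definition ore (A : pzRingType) (n : nat) (sigma : {rmorphism A -> 'M[A]_n})
  (delta : sigma_derivation sigma) : Type := {malg A[{fmonom 'I_n}]}.

HB.instance Definition _ (A : pzRingType) (n : nat)
  (sigma : {rmorphism A -> 'M[A]_n}) (delta : sigma_derivation sigma) :=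
  GRing.Zmodule.copy (ore delta) {malg A[{fmonom 'I_n}]}.

Section MalgExtension.
Context (A V : zmodType) (K : choiceType) (F : K -> A -> V).
Hypothesis FD : forall k, {morph F k : x y / x + y}.
Implicit Types f g : {malg A[K]}.

Let ext g : V := \sum_(k <- msupp g) F k g@_k.

Let extEw (d : {fset K}) g : (msupp g `<=` d)%fset ->
  ext g = \sum_(k <- d) F k g@_k.
Proof.
move=> le; rewrite /ext; apply/big_fset_incl => //.
move=> k _ /mcoeff_outdom ->.
by apply: (addrI (F k 0)); rewrite -FD !addr0.
Qed.

Lemma malg_extD f g :
  \sum_(k <- msupp (f + g)) F k (f + g)@_k =
  \sum_(k <- msupp f) F k f@_k + \sum_(k <- msupp g) F k g@_k.
Proof.
pose d := (msupp f `|` msupp g)%fset.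
rewrite -![LHS]/(ext _) (@extEw d) ?msuppD_le// -/(ext f) -/(ext g).
rewrite (@extEw d f) ?fsubsetUl// (@extEw d g) ?fsubsetUr// -big_split/=.
by apply: eq_bigr => k _; rewrite mcoeffD FD.
Qed.

Lemma malg_extU (c : A) (k : K) :
  \sum_(k' <- msupp << c *g k >>) F k' << c *g k >>@_k' = F k c.
Proof. by rewrite -[LHS]/(ext _) (extEw msuppU_le) big_seq_fset1 mcoeffUU. Qed.

End MalgExtension.

(* Locked, like the operations below: the unifier gets lost when it compares
   sums of unfolded terms. *)
HB.lock Definition oreU (A : pzRingType) (n : nat)
  (sigma : {rmorphism A -> 'M[A]_n})
  (delta : sigma_derivation sigma)
  (c : A) (m : {fmonom 'I_n}) : ore delta := << c *g m >>.
Arguments oreU {A n sigma delta} c m.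

HB.lock Definition ore_scale (A : pzRingType) (n : nat)
  (sigma : {rmorphism A -> 'M[A]_n})
  (delta : sigma_derivation sigma)
  (c : A) (g : ore delta) : ore delta :=
  \sum_(m <- msupp g) oreU (c * g@_m) m.
Arguments ore_scale {A n sigma delta} c g.

(* Left multiplication by t_i on S, the rule for t_i * a being applied to each
   term: t_i (a m) = \sum_j sigma_ij(a) (t_j m) + delta_i(a) m. *)
HB.lock Definition ore_lmulX (A : pzRingType) (n : nat)
  (sigma : {rmorphism A -> 'M[A]_n})
  (delta : sigma_derivation sigma)
  (i : 'I_n) (g : ore delta) : ore delta :=
  \sum_(m <- msupp g)
    (\sum_(j < n) oreU (sigma g@_m i j) (mmul (fmu j) m)
     + oreU (sder delta i g@_m) m).
Arguments ore_lmulX {A n sigma delta} i g.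

HB.lock Definition ore_mul (A : pzRingType) (n : nat)
  (sigma : {rmorphism A -> 'M[A]_n})
  (delta : sigma_derivation sigma)
  (f g : ore delta) : ore delta :=
  \sum_(m <- msupp f) ore_scale f@_m (word_act ore_lmulX m g).
Arguments ore_mul {A n sigma delta} f g.

Section OreExtension.
Context (A : pzRingType) (n : nat) (sigma : {rmorphism A -> 'M[A]_n}).
Context (delta : sigma_derivation sigma).
Local Notation S := (ore delta).
Implicit Types (f g h : S) (m : {fmonom 'I_n}) (c : A).

Definition oreC (c : A) : S := oreU c mone.
Definition oreX (i : 'I_n) : S := oreU 1 (fmu i).

Lemma ore_extU (V : zmodType) (F : {fmonom 'I_n} -> A -> V) c m :
  (forall m, {morph F m : x y / x + y}) ->
  \sum_(m' <- msupp (oreU c m : S)) F m' (oreU c m : S)@_m' = F m c.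
Proof. by move=> FD; rewrite oreU.unlock malg_extU. Qed.

Lemma oreUD m : {morph (fun c => oreU c m : S) : x y / x + y}.
Proof. by move=> x y; rewrite oreU.unlock monalgUD. Qed.

Lemma oreU0 m : oreU 0 m = 0 :> S.
Proof. by rewrite oreU.unlock monalgU0. Qed.

Lemma ore_sumE f : f = \sum_(m <- msupp f) oreU f@_m m.
Proof. by rewrite oreU.unlock; apply: monalgE. Qed.

Lemma ore_ind (P : S -> Prop) : (forall f g, P f -> P g -> P (f + g)) ->
  (forall c m, P (oreU c m)) -> forall f, P f.
Proof.
move=> PD PU f; rewrite (ore_sumE f); apply: big_ind => //.
by rewrite -(oreU0 mone); apply: PU.
Qed.

Lemma ore_scaleDr c : {morph @ore_scale _ _ _ delta c : f g / f + g}.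
Proof.
rewrite ore_scale.unlock => f g.
apply: (malg_extD (F := fun m x => oreU (c * x) m : S)).
by move=> m x y; rewrite mulrDr oreUD.
Qed.

Lemma ore_scaleU c d m : ore_scale c (oreU d m) = oreU (c * d) m :> S.
Proof.
rewrite ore_scale.unlock; apply: (ore_extU (F := fun m x => oreU (c * x) m : S)).
by move=> k x y; rewrite mulrDr oreUD.
Qed.

Lemma ore_scaleDl c d f : ore_scale (c + d) f = ore_scale c f + ore_scale d f.
Proof.
elim/ore_ind: f => [f g IHf IHg|a m]; last by rewrite !ore_scaleU mulrDl oreUD.
by rewrite !ore_scaleDr IHf IHg addrACA.
Qed.

Lemma ore_scaleA c d f : ore_scale c (ore_scale d f) = ore_scale (c * d) f.
Proof.
elim/ore_ind: f => [f g IHf IHg|a m]; last by rewrite !ore_scaleU mulrA.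
by rewrite !ore_scaleDr IHf IHg.
Qed.

Lemma ore_scale1 f : ore_scale 1 f = f.
Proof.
elim/ore_ind: f => [f g IHf IHg|a m]; last by rewrite ore_scaleU mul1r.
by rewrite ore_scaleDr IHf IHg.
Qed.

Let lmulX_termD i m : {morph (fun x => \sum_(j < n)
  oreU (sigma x i j) (mmul (fmu j) m) + oreU (sder delta i x) m : S) :
  x y / x + y}.
Proof.
move=> x y /=; rewrite (raddfD (sder delta i)) oreUD addrACA -big_split; congr (_ + _).
by apply: eq_bigr => j _; rewrite rmorphD mxE oreUD.
Qed.

Lemma ore_lmulXD i : {morph @ore_lmulX _ _ _ delta i : f g / f + g}.
Proof. rewrite ore_lmulX.unlock => f g; apply: (malg_extD (F := fun m x => \sum_(j < n)
  oreU (sigma x i j) (mmul (fmu j) m) + oreU (sder delta i x) m : S)).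
exact: lmulX_termD. Qed.

Lemma ore_lmulXU i c m : ore_lmulX i (oreU c m : S) =
  \sum_(j < n) oreU (sigma c i j) (mmul (fmu j) m) + oreU (sder delta i c) m.
Proof.
rewrite ore_lmulX.unlock; exact: (ore_extU (F := fun m x => \sum_(j < n)
  oreU (sigma x i j) (mmul (fmu j) m) + oreU (sder delta i x) m : S)).
Qed.

Lemma word_lmulXD m : {morph word_act (@ore_lmulX _ _ _ delta) m : f g / f + g}.
Proof.
move=> f g; elim/fmonom_ind: m => [|i m IHm]; first by rewrite !word_act1.
by rewrite !word_actM !word_actX IHm ore_lmulXD.
Qed.

Lemma ore_mulDl : left_distributive (@ore_mul _ _ _ delta) +%R.
Proof.
rewrite ore_mul.unlock => f g h.
apply: (malg_extD (F := fun m x => ore_scale x (word_act ore_lmulX m h))).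
by move=> m x y; rewrite ore_scaleDl.
Qed.

Lemma ore_mulUl c m f : ore_mul (oreU c m) f =
  ore_scale c (word_act ore_lmulX m f).
Proof.
rewrite ore_mul.unlock.
apply: (ore_extU (F := fun m x => ore_scale x (word_act ore_lmulX m f))).
by move=> k x y; rewrite ore_scaleDl.
Qed.

Lemma ore_mulDr : right_distributive (@ore_mul _ _ _ delta) +%R.
Proof.
move=> f g h; rewrite ore_mul.unlock -big_split; apply: eq_bigr => m _ /=.
by rewrite word_lmulXD ore_scaleDr.
Qed.

Lemma sder1 i : sder delta i 1 = 0.
Proof.
apply: (addrI (sder delta i 1)); rewrite addr0.
have := sderM delta i 1 1; rewrite !mulr1 rmorph1 => {3}->.
rewrite (bigD1 i)//= mxE eqxx mul1r big1 ?addr0// => j /negPf ji.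
by rewrite mxE eq_sym ji mul0r.
Qed.

Lemma ore_lmulX_mon i m : ore_lmulX i (oreU 1 m : S) = oreU 1 (mmul (fmu i) m).
Proof.
rewrite ore_lmulXU sder1 oreU0 addr0 rmorph1 (bigD1 i)//= mxE eqxx.
rewrite big1 ?addr0// => j /negPf ji; rewrite mxE eq_sym ji.
exact: oreU0.
Qed.

Lemma word_lmulX_mon m m' :
  word_act ore_lmulX m (oreU 1 m' : S) = oreU 1 (mmul m m').
Proof.
elim/fmonom_ind: m => [|i m IHm]; first by rewrite word_act1 mul1m.
by rewrite word_actM word_actX IHm ore_lmulX_mon mulmA.
Qed.

Lemma ore_mul1f : left_id (oreU 1 mone : S) ore_mul.
Proof.
by move=> f; rewrite ore_mulUl ore_scale1 word_act1.
Qed.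

Lemma ore_mulf1 : right_id (oreU 1 mone : S) ore_mul.
Proof.
move=> f; rewrite [RHS]ore_sumE ore_mul.unlock; apply: eq_bigr => m _.
by rewrite word_lmulX_mon ore_scaleU mulr1 mulm1.
Qed.

Lemma ore_scale_sum c I (r : seq I) (F : I -> S) :
  ore_scale c (\sum_(i <- r) F i) = \sum_(i <- r) ore_scale c (F i).
Proof.
apply: (big_morph _ (ore_scaleDr c)).
by rewrite ore_scale.unlock msupp0 big_seq_fset0.
Qed.

Lemma ore_scale_suml I (r : seq I) (F : I -> A) f :
  ore_scale (\sum_(i <- r) F i) f = \sum_(i <- r) ore_scale (F i) f.
Proof.
apply: (big_morph (ore_scale ^~ f) (fun c d => ore_scaleDl c d f)).
by apply: (addrI (ore_scale 0 f)); rewrite -ore_scaleDl !addr0.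
Qed.

Lemma ore_lmulX_scale i c f : ore_lmulX i (ore_scale c f) =
  \sum_(j < n) ore_scale (sigma c i j) (ore_lmulX j f)
  + ore_scale (sder delta i c) f.
Proof.
elim/ore_ind: f => [f g IHf IHg|a m].
  rewrite !ore_scaleDr ore_lmulXD IHf IHg addrACA -big_split; congr (_ + _).
  by apply: eq_bigr => j _; rewrite ore_lmulXD ore_scaleDr.
rewrite ore_scaleU ore_lmulXU.
under [in RHS]eq_bigr => j _ do rewrite ore_lmulXU ore_scaleDr ore_scale_sum.
rewrite big_split /= ore_scaleU sderM oreUD addrA; congr (_ + _ + _).
  rewrite exchange_big /=; apply: eq_bigr => j _.
  under [in RHS]eq_bigr => k _ do rewrite ore_scaleU.
  rewrite rmorphM mxE.
  exact: (big_morph (fun c => oreU c _ : S) (oreUD _) (oreU0 _)).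
under [in RHS]eq_bigr => k _ do rewrite ore_scaleU.
exact: (big_morph (fun c => oreU c _ : S) (oreUD _) (oreU0 _)).
Qed.

Lemma ore_mulZl c f g : ore_mul (ore_scale c f) g = ore_scale c (ore_mul f g).
Proof.
elim/ore_ind: f => [f h IHf IHh|a m].
  by rewrite ore_scaleDr !ore_mulDl IHf IHh ore_scaleDr.
by rewrite ore_scaleU !ore_mulUl ore_scaleA.
Qed.

Lemma ore_mul_suml I (r : seq I) (F : I -> S) g :
  ore_mul (\sum_(i <- r) F i) g = \sum_(i <- r) ore_mul (F i) g.
Proof.
apply: (big_morph (ore_mul ^~ g) (fun f h => ore_mulDl f h g)).
by rewrite ore_mul.unlock msupp0 big_seq_fset0.
Qed.

Lemma ore_mul_lmulX i f g : ore_mul (ore_lmulX i f) g = ore_lmulX i (ore_mul f g).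
Proof.
elim/ore_ind: f => [f h IHf IHh|a m].
  by rewrite ore_lmulXD !ore_mulDl IHf IHh ore_lmulXD.
rewrite ore_lmulXU ore_mulDl ore_mul_suml !ore_mulUl ore_lmulX_scale.
congr (_ + _); apply: eq_bigr => j _; rewrite ore_mulUl; congr ore_scale.
by rewrite word_actM word_actX.
Qed.

Lemma ore_mulA : associative (@ore_mul _ _ _ delta).
Proof.
move=> f g h; elim/ore_ind: f => [f f' IHf IHf'|a m].
  by rewrite !ore_mulDl IHf IHf'.
rewrite !ore_mulUl ore_mulZl; congr ore_scale.
elim/fmonom_ind: m => [|i m IHm]; first by rewrite !word_act1.
by rewrite !word_actM !word_actX ore_mul_lmulX IHm.
Qed.

HB.instance Definition _ := GRing.Zmodule_isPzRing.Build S
  ore_mulA ore_mul1f ore_mulf1 ore_mulDl ore_mulDr.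

(* The defining properties of A[t; sigma, delta]: the oreC c are the elements
   of A, and the oreU 1 m are the words in the t_i = oreX i. *)
Lemma oreC_is_zmod_morphism : zmod_morphism oreC.
Proof. by move=> x y; rewrite /oreC oreU.unlock monalgUB. Qed.

Lemma oreC_is_monoid_morphism : monoid_morphism oreC.
Proof.
split=> // x y.
by rewrite -[RHS]/(ore_mul _ _) ore_mulUl word_act1 ore_scaleU.
Qed.

HB.instance Definition _ :=
  GRing.isZmodMorphism.Build A S oreC oreC_is_zmod_morphism.
HB.instance Definition _ :=
  GRing.isMonoidMorphism.Build A S oreC oreC_is_monoid_morphism.

Lemma oreUE c m : oreU c m = oreC c * oreU 1 m.
Proof.
by rewrite -[RHS]/(ore_mul _ _) ore_mulUl word_act1 ore_scaleU mulr1.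
Qed.

Lemma oreUM m m' : oreU 1 (mmul m m') = oreU 1 m * oreU 1 m' :> S.
Proof.
by rewrite -[RHS]/(ore_mul _ _) ore_mulUl word_lmulX_mon ore_scale1.
Qed.

Lemma oreXC i c : oreX i * oreC c =
  \sum_(j < n) oreC (sigma c i j) * oreX j + oreC (sder delta i c).
Proof.
rewrite -[LHS]/(ore_mul _ _) ore_mulUl ore_scale1 word_actX ore_lmulXU.
by congr (_ + _); apply: eq_bigr => j _; rewrite mulm1 oreUE.
Qed.

(* I = S (t_1 - a_1) + ... + S (t_n - a_n) *)
Definition ore_point_ideal (a : 'cV[A]_n) (f : S) : Prop :=
  exists g : 'I_n -> S, f = \sum_(i < n) g i * (oreX i - oreC (a i 0)).

(* f(a): the unique element of A congruent to f modulo I. *)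
Definition ore_eval (f : S) (a : 'cV[A]_n) : A :=
  epsilon (inhabits 0)
    (unique (fun b : A => ore_point_ideal a (f - oreC b))).

Definition ore_T (a : 'cV[A]_n) (i : 'I_n) (b : A) : A :=
  \sum_(j < n) sigma b i j * a j 0 + sder delta i b.

(* f(T), for a family T of maps A -> A *)
Definition ore_subst (f : S) (T : 'I_n -> A -> A) (b : A) : A :=
  \sum_(m <- msupp f) f@_m * word_act T m b.

End OreExtension.

Arguments oreC {A n sigma delta} c.
Arguments oreX {A n sigma delta} i.

(* Main.v *)
(** The family [T_a] makes [A] a left [S]-module in which [f] acts as [f(T_a)].
    Since [T_a_i(1) = a_i], the ideal [I] annihilates [1]; hence [f - b \in I]
    forces [f(T_a)(1) = b]. Conversely [t_i b - T_a_i(b)] lies in [I] for [b]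
    in [A], so by induction on words [f - f(T_a)(1)] lies in [I]. *)
Require Import Defs.
From mathcomp Require Import all_boot all_order all_algebra.
From mathcomp.multinomials Require Import monalg.
From Stdlib Require Import ClassicalEpsilon.
Import GRing.Theory.
Local Open Scope ring_scope.

Section Substitution.
Context {A : pzRingType} {n : nat} {sigma : {rmorphism A -> 'M[A]_n}}.
Context {delta : sigma_derivation sigma}.
Local Notation S := (ore delta).
Implicit Types (f g : S) (T : 'I_n -> A -> A) (b c : A).

(** Linearity in the polynomial comes from coefficients acting by left multiplication, so [T] may be
    any family of maps here; products need the specific family [ore_T]. *)
Lemma ore_substD f g T b :
  ore_subst (f + g) T b = ore_subst f T b + ore_subst g T b.
Proof.
apply: (@malg_extD _ _ _ (fun m x => x * word_act T m b)).
by move=> m x y; rewrite mulrDl.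
Qed.

Lemma ore_substU c m T b : ore_subst (oreU c m : S) T b = c * word_act T m b.
Proof.
apply: (@ore_extU _ _ _ delta _ (fun m x => x * word_act T m b)).
by move=> k x y; rewrite mulrDl.
Qed.

Lemma ore_substC c T b : ore_subst (oreC c : S) T b = c * b.
Proof. by rewrite ore_substU word_act1. Qed.

Lemma ore_subst_scale c f T b :
  ore_subst (ore_scale c f) T b = c * ore_subst f T b.
Proof.
elim/ore_ind: f => [f g IHf IHg|d m].
  by rewrite ore_scaleDr !ore_substD IHf IHg mulrDr.
by rewrite ore_scaleU !ore_substU mulrA.
Qed.

Lemma ore_subst0l T b : ore_subst (0 : S) T b = 0.
Proof. by rewrite -(oreU0 delta mone) ore_substU mul0r. Qed.

Lemma ore_substB f g T b :
  ore_subst (f - g) T b = ore_subst f T b - ore_subst g T b.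
Proof. by apply: (addIr (ore_subst g T b)); rewrite -ore_substD !subrK. Qed.

Lemma ore_subst_sum I (r : seq I) (F : I -> S) T b :
  ore_subst (\sum_(i <- r) F i) T b = \sum_(i <- r) ore_subst (F i) T b.
Proof.
apply: (big_morph (fun f => ore_subst f T b)) => [f g|]; first exact: ore_substD.
exact: ore_subst0l.
Qed.

End Substitution.

Section Evaluation.
Context {A : pzRingType} {n : nat} {sigma : {rmorphism A -> 'M[A]_n}}.
Context {delta : sigma_derivation sigma} (a : 'cV[A]_n).
Local Notation S := (ore delta).
Local Notation T := (ore_T delta a).
Implicit Types (f g : S) (b c : A).

Lemma ore_TD i : {morph T i : x y / x + y}.
Proof.
move=> x y; rewrite /ore_T (raddfD (sder delta i)) addrACA -big_split; congr (_ + _).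
by apply: eq_bigr => j _; rewrite rmorphD mxE mulrDl.
Qed.

(** The operators [T i] commute past left multiplications by the same rule as the variables [t_i]
    past coefficients; this is what makes [A] a left [S]-module. *)
Lemma ore_TM i b c : T i (b * c) = \sum_(j < n) sigma b i j * T j c + sder delta i b * c.
Proof.
rewrite /ore_T sderM addrA; congr (_ + _).
under [in RHS]eq_bigr => j _ do rewrite mulrDr mulr_sumr.
(* As [sigma] turns products into matrix products, both sides contain the double sum of
   [sigma b i j * sigma c j k * a k 0]. *)
rewrite big_split /= exchange_big; congr (_ + _); apply: eq_bigr => j _.
rewrite rmorphM mxE mulr_suml.
by apply: eq_bigr => k _; rewrite mulrA.
Qed.

Lemma ore_T1 i : T i 1 = a i 0.
Proof.
rewrite /ore_T sder1 addr0 rmorph1 (bigD1 i) //= mxE eqxx mul1r big1 ?addr0 //.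
by move=> j /negPf ji; rewrite mxE eq_sym ji mul0r.
Qed.

(** Multiplicativity for a left factor [t_i]: on a single term it is [ore_TM]. Induction on words
    then gives all left factors. *)
Lemma ore_subst_lmulX i f b : ore_subst (ore_lmulX i f) T b = T i (ore_subst f T b).
Proof.
elim/ore_ind: f => [f g IHf IHg|c m].
  by rewrite ore_lmulXD !ore_substD IHf IHg ore_TD.
rewrite ore_lmulXU ore_substD ore_subst_sum !ore_substU ore_TM; congr (_ + _).
by apply: eq_bigr => j _; rewrite ore_substU word_actM word_actX.
Qed.

Lemma ore_substM f g b : ore_subst (f * g) T b = ore_subst f T (ore_subst g T b).
Proof.
elim/ore_ind: f => [f h IHf IHh|c m]; first by rewrite mulrDl !ore_substD IHf IHh.
rewrite -[_ * _]/(ore_mul _ _) ore_mulUl ore_subst_scale ore_substU; congr (_ * _).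
elim/fmonom_ind: m => [|i m IHm]; first by rewrite !word_act1.
by rewrite !word_actM !word_actX ore_subst_lmulX IHm.
Qed.

Lemma ore_subst0r f : ore_subst f T 0 = 0.
Proof.
(* The argument 0 is the value at 1 of the zero constant of [S], so it can be absorbed into the
   product [f * 0]. *)
rewrite -[0 in LHS](mul0r 1) -(ore_substC (delta := delta) 0 T) -ore_substM.
by rewrite rmorph0 mulr0 ore_subst0l.
Qed.

Lemma ore_subst_ideal f : ore_point_ideal a f -> ore_subst f T 1 = 0.
Proof.
case=> g ->; rewrite ore_subst_sum big1 // => i _.
rewrite ore_substM ore_substB ore_substC ore_substU word_actX ore_T1.
by rewrite mul1r mulr1 subrr ore_subst0r.
Qed.

Lemma ore_point_ideal0 : ore_point_ideal a (0 : S).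
Proof. by exists (fun=> 0); rewrite big1 // => i _; rewrite mul0r. Qed.

Lemma ore_point_idealD f g :
  ore_point_ideal a f -> ore_point_ideal a g -> ore_point_ideal a (f + g).
Proof.
move=> [p ->] [q ->]; exists (fun i => p i + q i).
by rewrite -big_split; apply: eq_bigr => i _; rewrite mulrDl.
Qed.

Lemma ore_point_idealMl f g : ore_point_ideal a g -> ore_point_ideal a (f * g).
Proof.
move=> [q ->]; exists (fun i => f * q i).
by rewrite mulr_sumr; apply: eq_bigr => i _; rewrite mulrA.
Qed.

Lemma ore_point_ideal_T i b :
  ore_point_ideal a (oreX i * oreC b - oreC (T i b) : S).
Proof.
(* The derivation terms cancel, leaving [t_i b - T_i(b)] as the sum over [j] of
   [sigma b i j * (t_j - a_j)]. *)
exists (fun j => oreC (sigma b i j)).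
rewrite oreXC /ore_T raddfD raddf_sum /= opprD addrACA subrr addr0 -sumrB.
by apply: eq_bigr => j _; rewrite rmorphM mulrBr.
Qed.

Lemma ore_point_ideal_subst f :
  ore_point_ideal a (f - oreC (ore_subst f T 1)).
Proof.
elim/ore_ind: f => [f g IHf IHg|c m].
  rewrite ore_substD raddfD opprD addrACA; exact: ore_point_idealD.
(* The coefficient [c] factors out on the left, which reduces the claim to a bare word. *)
rewrite ore_substU oreUE rmorphM -mulrBr; apply: ore_point_idealMl.
elim/fmonom_ind: m => [|i m IHm].
  by rewrite word_act1 subrr; exact: ore_point_ideal0.
rewrite word_actM word_actX oreUM -/(oreX i).
(* With [b] the value of the word [m] at 1, the difference splits as
   [t_i (m - b) + (t_i b - T_i(b))]. *)
rewrite -(subrKA (oreX i * oreC (word_act T m 1))) -mulrBr.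
apply: ore_point_idealD; first exact: ore_point_idealMl.
exact: ore_point_ideal_T.
Qed.

End Evaluation.

Theorem proposition4p3 (A : pzRingType) (n : nat) (n_gt0 : (0 < n)%N)
    (sigma : {rmorphism A -> 'M[A]_n}) (delta : sigma_derivation sigma)
    (f : ore delta) (a : 'cV[A]_n) :
  ore_eval f a = ore_subst f (ore_T delta a) 1.
Proof.
have eval_uniq b :
    ore_point_ideal a (f - oreC b) -> ore_subst f (ore_T delta a) 1 = b.
  move/ore_subst_ideal; rewrite ore_substB ore_substC mulr1.
  by move/eqP; rewrite subr_eq0 => /eqP.
rewrite /ore_eval; set P := unique _.
(* The choice operator satisfies [P] once some element does; [eval_uniq] serves both for uniqueness
   of that element and for identifying the chosen one. *)
have [exP _] : P (epsilon (inhabits 0) P).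
  apply: epsilon_spec; exists (ore_subst f (ore_T delta a) 1).
  by split; [exact: ore_point_ideal_subst | exact: eval_uniq].
by rewrite (eval_uniq _ exP).
Qed.
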